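(* Let $\mathcal{N}=\mathcal{R}\cup\mathcal{B}$ be a finite set of players partitioned into retailers $\mathcal{R}$ and consumers $\mathcal{B}$, and let $\{S_r\}_{r\in\mathcal{R}}$ be retailer coalitions, $S_r=\{r\}\cup\mathcal{B}_r$ with $\mathcal{B}_r\subset\mathcal{B}$, such that $\bigcup_{r\in\mathcal{R}}S_r=\mathcal{N}$, no $S_r$ contains a retailer other than $r$, and $S_r\cap S_s=\emptyset$ for distinct $r,s\in\mathcal{R}$. Let the consumer demands be random processes and let consumer profits be as defined in the context. Then for every $r\in\mathcal{R}$, almost surely, $$\Pi_{S_r}(\mathbf{P}^d_{S_r},r)\;\ge\;\sum_{b\in S_r\cap\mathcal{B}}\Pi_{\{r,b\}}(\mathbf{P}^d_{b},r).$$
   Context: Viable coalition: a subset of $\mathcal{N}$ containing exactly one retailer. Each retailer $r$ has a cost network: an undirected graph with symmetric real edge weights $\omega(\cdot,\cdot)$ containing all links $(r,b)$ between $r$ and consumers $b$, and possibly links between consumers. For a viable coalition $S\ni r$, $c(S)$ is the total weight of a minimum spanning tree of the subgraph induced on $S$ (with $c(\{r\})=0$). The value function is $\nu(S)=\sum_{b\in S\cap\mathcal{B}}\omega(r,b)-c(S)$ for viable $S\ni r$, and $\nu(X)=0$ for nonviable $X$. Shapley value: for a viable coalition $S$ with retailer $r$ and $k$ consumers, consider all $k!$ orderings $\sigma=(r,b_{i_1},\dots,b_{i_k})$ of $S$ starting with $r$. The marginal value of $b$ is $m_b^\sigma=\nu(\rho_b^\sigma\cup\{b\})-\nu(\rho_b^\sigma)$,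 where $\rho_b^\sigma$ is the set of elements of $S$ preceding $b$ in $\sigma$. The Shapley value of $b$ in $S$ is $\Phi_b=\frac1{k!}\sum_\sigma m_b^\sigma$. Consumer profit: a consumer $b$ in a viable coalition $S$ with retailer $r$, consuming $\zeta$ at price $\lambda_r$, has profit $$\Pi_b(\zeta,r)=\alpha_b\,\zeta^{1/6}+\kappa_r\delta_b^r-\omega(r,b)-\lambda_r\zeta,$$ where the subsidy $\kappa_r\delta_b^r$ equals the Shapley value of $b$ in the coalition $S$ it belongs to. The price $\lambda_r$ is the same given price in every coalition containing $r$. Stochastic demand: each $\alpha_b(t)$ is a random variable with distribution $N(\mu_b,\sigma^2)$, and the demand $P_b^d(t)\in[\underline{P}_b,\bar P_b]$ (with $\underline P_b\ge 0$) is the resulting stochastic process, denoted $\mathbf{P}^d_b$. The coalition demand process is $\mathbf{P}^d_{S_r}$, with $P^d_{S_r}(t)=\sum_{b\in S_r\cap\mathcal{B}}P_b^d(t)$. Total coalition consumer profit: $\Pi_{S_r}(\mathbf{P}^d_{S_r},r)=\sum_{b\in S_r\cap\mathcal{B}}\Pi_b(P_b^d,r)$, with subsidies computed in the coalition $S_r$. Individual profit: $\Pi_{\{r,b\}}(\mathbf{P}^d_b,r)$ is the profit $\Pi_b(P_b^d,r)$ of the same consumer with the same demand when its coalition is just $\{r,b\}$, with the subsidy computed in $\{r,b\}$. The inequality is understood at each time $t$. *)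

(* Defs.v *)
From HB Require Import structures.
From mathcomp Require Import all_boot all_order all_algebra.
From mathcomp Require Import all_classical all_reals all_analysis.

Set Implicit Arguments.
Unset Strict Implicit.
Unset Printing Implicit Defensive.

Import Order.TTheory GRing.Theory Num.Theory.
Local Open Scope ring_scope.

(* The set of players is the disjoint union of the retailers and the
   consumers: [inl r] is a retailer and [inr b] is a consumer. *)
Definition player (Rt Bt : finType) : finType := (Rt + Bt)%type.

Definition retailers_in (Rt Bt : finType) (S : {set player Rt Bt}) : {set Rt} :=
  [set r : Rt | inl r \in S].

Definition viable (Rt Bt : finType) (S : {set player Rt Bt}) : bool :=
  #|retailers_in S| == 1%N.

Record cost_network (R : realType) (Rt Bt : finType) (r : Rt) := CostNetwork {
  link : rel (player Rt Bt);
  weight : player Rt Bt -> player Rt Bt -> R;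
  link_sym : symmetric link;
  link_irr : irreflexive link;
  weight_sym : forall x y, weight x y = weight y x;
  link_retailer : forall b : Bt, link (inl r) (inr b);
  (* all other links are between consumers *)
  link_no_other_retailer : forall (s : Rt) (x : player Rt Bt),
    link (inl s) x -> s = r
}.

(* A set of undirected edges is encoded as a symmetric set of ordered pairs. *)
Definition edge_rel (V : finType) (T : {set V * V}) : rel V :=
  fun x y => (x, y) \in T.

(* For an irreflexive symmetric relation the cycles of length 1 do not occur
   and those of length 2 only run back and forth along one edge. *)
Definition acyclic (V : finType) (T : {set V * V}) : Prop :=
  forall p : seq V, ucycle (edge_rel T) p -> (size p <= 2)%N.

Section CostNetwork.
Variables (R : realType) (Rt Bt : finType) (r : Rt).
Variable net : cost_network R Bt r.
Local Notation V := (player Rt Bt).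

Definition spanning_tree (S : {set V}) (T : {set V * V}) : Prop :=
  [/\ forall x y, edge_rel T x y -> [/\ x \in S, y \in S & link net x y],
      symmetric (edge_rel T),
      forall x y, x \in S -> y \in S -> connect (edge_rel T) x y
    & acyclic T].

(* Each undirected edge occurs in T as two ordered pairs. *)
Definition tree_weight (T : {set V * V}) : R :=
  (\sum_(e in T) weight net e.1 e.2) / 2.

Definition minimum_spanning_tree (S : {set V}) (T : {set V * V}) : Prop :=
  spanning_tree S T /\
  forall T', spanning_tree S T' -> tree_weight T <= tree_weight T'.

(* On a viable coalition containing r a minimum spanning tree exists, because
   of the links from r to the consumers; the default is then never used. *)
Definition mst_cost (S : {set V}) : R :=
  tree_weight (xget finset.set0 (minimum_spanning_tree S)).

End CostNetwork.

Section Game.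
Variables (R : realType) (Rt Bt : finType).
Variable net : forall r : Rt, cost_network R Bt r.
Local Notation V := (player Rt Bt).

Definition value (S : {set V}) : R :=
  if [pick r | retailers_in S == [set r]] is Some r then
    (\sum_(b : Bt | inr b \in S) weight (net r) (inl r) (inr b))
      - mst_cost (net r) S
  else 0.

Definition consumers_in (S : {set V}) : {set Bt} := [set b : Bt | inr b \in S].

Definition orderings (r : Rt) (S : {set V}) : seq (seq V) :=
  [seq inl r :: map inr s | s <- permutations (enum (consumers_in S))].

Definition predecessors (sigma : seq V) (x : V) : {set V} :=
  [set y in take (index x sigma) sigma].

Definition marginal (sigma : seq V) (b : Bt) : R :=
  value (inr b |: predecessors sigma (inr b))
    - value (predecessors sigma (inr b)).

Definition shapley (r : Rt) (S : {set V}) (b : Bt) : R :=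
  ((#|consumers_in S|)`!%:R)^-1 * \sum_(sigma <- orderings r S) marginal sigma b.

(* The subsidy [kappa S r * delta S r b] depends on the coalition S to which
   the consumer b belongs. *)
Variables (kappa : {set V} -> Rt -> R) (delta : {set V} -> Rt -> Bt -> R).
Variable price : Rt -> R.

Definition consumer_profit (S : {set V}) (r : Rt) (b : Bt) (alpha zeta : R) : R :=
  alpha * zeta `^ (6^-1) + kappa S r * delta S r b
    - weight (net r) (inl r) (inr b) - price r * zeta.

(* [alpha] and [demand] list the utility coefficients and demands of all
   consumers. *)
Definition coalition_profit (S : {set V}) (r : Rt) (alpha demand : Bt -> R) : R :=
  \sum_(b in consumers_in S) consumer_profit S r b (alpha b) (demand b).

End Game.

(* N(m, s^2), including the point mass at m when s = 0, a case for which the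
   library's [normal_prob] takes another value. *)
Definition normal_law (R : realType) (m s : R) (A : set R) : \bar R :=
  if s == 0 then \d_m A else normal_prob m s A.

(* Main.v *)
(* The Shapley values of the consumers of a coalition sum to its value: along
   each ordering the marginal values telescope, from the value 0 of the lone
   retailer.  This value is nonnegative, because the star of links between the
   retailer and the consumers is a spanning tree whose weight bounds the cost of
   a minimum one.  With a single consumer the star is the only spanning tree, so
   the Shapley value in {r, b} is 0.  The terms of the profits other than the
   subsidy agree on both sides, so the inequality holds at every outcome. *)

Require Import Defs.
From HB Require Import structures.
From mathcomp Require Import all_boot all_order all_algebra.
From mathcomp Require Import all_classical all_reals all_analysis.
From mathcomp Require Import ring.

Set Implicit Arguments.
Unset Strict Implicit.
Unset Printing Implicit Defensive.

Import Order.TTheory GRing.Theory Num.Theory.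
Local Open Scope ring_scope.

Lemma big_player (R : nmodType) (Rt Bt : finType) (P : pred (player Rt Bt))
    (F : player Rt Bt -> R) :
  \sum_(x | P x) F x =
    \sum_(s | P (inl s)) F (inl s) + \sum_(b | P (inr b)) F (inr b).
Proof. exact: big_sumType. Qed.

(** * Minimum spanning trees of a coalition and the star around its retailer *)

Section CostNetworkTheory.
Variables (R : realType) (Rt Bt : finType) (r : Rt).
Variable net : cost_network R Bt r.
Local Notation V := (player Rt Bt).
Implicit Types (A : {set Bt}) (T : {set V * V}) (S : {set V}).

Definition coalition A : {set V} := inl r |: [set inr b | b in A].

Lemma inr_coalition A b : (inr b \in coalition A) = (b \in A).
Proof. by rewrite !inE /= mem_imset // => x y []. Qed.

Lemma inl_coalition A s : (inl s \in coalition A) = (s == r).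
Proof.
rewrite !inE; apply/orP/eqP => [[/eqP[] //|/imsetP[]//]|->].
by left.
Qed.

Lemma consumers_coalition A : consumers_in (coalition A) = A.
Proof. by apply/setP => b; rewrite inE inr_coalition. Qed.

Lemma retailers_coalition A : retailers_in (coalition A) = [set r]%SET.
Proof. by apply/setP => s; rewrite [LHS]inE inl_coalition inE. Qed.

Lemma viable_coalition A : viable (coalition A).
Proof. by rewrite /viable retailers_coalition cards1. Qed.

Definition star_edge A : rel V := fun x y =>
  match x, y with
  | inl s, inr b | inr b, inl s => (s == r) && (b \in A)
  | _, _ => false
  end.

Definition star A : {set V * V} := [set e | star_edge A e.1 e.2].

Lemma edge_star A : edge_rel (star A) =2 star_edge A.
Proof. by move=> x y; rewrite /edge_rel inE. Qed.

Lemma star_edge_sym A : symmetric (star_edge A).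
Proof. by case=> [s|b] [s'|b']. Qed.

(** Along star edges [inl r] and consumers alternate, so a cycle through three or more vertices
    would visit [inl r] twice. *)
Lemma acyclic_star A : acyclic (star A).
Proof.
move=> p /andP[]; rewrite (eq_cycle (edge_star A)).
case: p => [|x [|y [|z p]]] //= /and3P[xy yz zp].
rewrite !inE !negb_or => /and3P[/and3P[_ xz _] /andP[_ yp] _].
case: x y z xy yz zp xz yp => [x|x] [y|y] [z|z] //=.
  by move=> /andP[/eqP-> _] /andP[/eqP-> _] _; rewrite eqxx.
move=> /andP[/eqP-> _] _; case: p => [|[u|u] p] //= /andP[/andP[/eqP-> _] _] _.
by rewrite inE eqxx.
Qed.

Lemma spanning_tree_star A : spanning_tree net (coalition A) (star A).
Proof.
split; last exact: acyclic_star.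
- move=> [s|b] [s'|b']; rewrite edge_star //= => /andP[/eqP-> bA];
    rewrite inl_coalition inr_coalition eqxx bA; split=> //.
    exact: link_retailer.
  by rewrite link_sym link_retailer.
- by move=> x y; rewrite !edge_star star_edge_sym.
have to_r x : x \in coalition A -> connect (edge_rel (star A)) x (inl r).
  case: x => [s|b]; first by rewrite inl_coalition => /eqP->.
  by rewrite inr_coalition => bA; apply: connect1; rewrite edge_star /= eqxx.
move=> x y xA yA; apply: (connect_trans (to_r x xA)).
rewrite sym_connect_sym ?to_r // => u v.
by rewrite !edge_star star_edge_sym.
Qed.

(** There are finitely many edge sets, so one spanning tree suffices for a lightest one to exist. *)
Lemma minimum_spanning_tree_exists S T :
  spanning_tree net S T -> exists T', minimum_spanning_tree net S T'.
Proof.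
move=> /asboolP sT.
pose P U := `[< spanning_tree net S U >].
case: (arg_minP (tree_weight net) (P := P) sT).
move=> T' /asboolP sT' min; exists T'; split=> // U /asboolP; exact: min.
Qed.

Lemma mst_cost_spanning A :
  exists2 T, minimum_spanning_tree net (coalition A) T
    & mst_cost net (coalition A) = tree_weight net T.
Proof.
have [T mT] := minimum_spanning_tree_exists (spanning_tree_star A).
by eexists; [exact: (xgetI finset.set0 mT)|].
Qed.

Lemma tree_weight_star A :
  tree_weight net (star A) = \sum_(b in A) weight net (inl r) (inr b).
Proof.
rewrite /tree_weight.
rewrite (eq_bigl (fun e => star_edge A e.1 e.2)); last by move=> e; rewrite inE.
rewrite -(pair_big_dep xpredT (star_edge A) (weight net)) /=.
(* Each link is counted once in the row of [r] and once in the row of its consumer; the division by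
   2 undoes this. *)
have row_inl s : \sum_(y | star_edge A (inl s) y) weight net (inl s) y
    = if s == r then \sum_(b in A) weight net (inl r) (inr b) else 0.
  rewrite big_player /= big_pred0_eq add0r.
  by case: eqP => [->|_] //; rewrite big_pred0_eq.
have row_inr b : \sum_(y | star_edge A (inr b) y) weight net (inr b) y
    = if b \in A then weight net (inl r) (inr b) else 0.
  rewrite big_player /= big_pred0_eq addr0.
  case: (b \in A); last by rewrite big_pred0 // => s; rewrite andbF.
  rewrite (big_pred1 r); first exact: weight_sym.
  by move=> s; rewrite andbT.
rewrite big_player /= (eq_bigr _ (fun s _ => row_inl s)).
rewrite (eq_bigr _ (fun b _ => row_inr b)) -!big_mkcond big_pred1_eq.
by rewrite -mulr2n -[X in X / 2]mulr_natr mulfK // pnatr_eq0.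
Qed.

Lemma mst_cost_le_star A :
  mst_cost net (coalition A) <= \sum_(b in A) weight net (inl r) (inr b).
Proof.
have [T [_ minT] ->] := mst_cost_spanning A.
by rewrite -tree_weight_star; apply/minT/spanning_tree_star.
Qed.

(** With at most one consumer and no loops, every edge joins [r] to that consumer, and connectedness
    forces this edge to be present. *)
Lemma spanning_tree_eq_star A T : (#|A| <= 1)%N ->
  spanning_tree net (coalition A) T -> T = star A.
Proof.
move=> /card_le1_eqP A1 [sub symT conT _].
have subT x y : edge_rel T x y -> star_edge A x y.
  move=> xy; have [] := sub _ _ xy.
  case: x y {xy} => [s|b] [s'|b']; rewrite ?inl_coalition ?inr_coalition.
  - by move=> /eqP-> /eqP->; rewrite link_irr.
  - by move=> /= -> ->.
  - by move=> /= -> ->.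
  - by move=> bA b'A; rewrite (A1 _ _ bA b'A) link_irr.
have rT b : b \in A -> edge_rel T (inl r) (inr b).
  move=> bA.
  (* The first edge of a path from [r] to [b] ends at a consumer in [A], which can only be [b]. *)
  have /connectP[[|x p] //= /andP[rx _] _] :
      connect (edge_rel T) (inl r) (inr b).
    by apply: conT; rewrite ?inl_coalition ?inr_coalition.
  case: x rx => x rx; first by have := subT _ _ rx.
  by have /= /andP[_ xA] := subT _ _ rx; rewrite -(A1 _ _ bA xA).
apply/setP => -[x y]; rewrite [RHS]inE /=; apply/idP/idP; first exact: subT.
case: x y => [s|b] [s'|b'] //= /andP[/eqP-> bA]; first exact: rT.
by have := rT _ bA; rewrite symT.
Qed.

Lemma mst_cost_card_le1 A : (#|A| <= 1)%N ->
  mst_cost net (coalition A) = \sum_(b in A) weight net (inl r) (inr b).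
Proof.
move=> A1; have [T [sT _] ->] := mst_cost_spanning A.
by rewrite (spanning_tree_eq_star A1 sT) tree_weight_star.
Qed.

End CostNetworkTheory.

(** * Values of coalitions and Shapley values *)

Section GameTheory.
Variables (R : realType) (Rt Bt : finType).
Variable net : forall r : Rt, cost_network R Bt r.
Implicit Types (r : Rt) (A : {set Bt}).

Lemma value_coalition r A : value net (coalition r A) =
  \sum_(b in A) weight (net r) (inl r) (inr b)
    - mst_cost (net r) (coalition r A).
Proof.
rewrite /value retailers_coalition.
case: pickP => [s /eqP/setP/(_ s)|/(_ r)]; last by rewrite eqxx.
rewrite !inE eqxx => /eqP ->; congr (_ - _).
by apply: eq_bigl => b; rewrite inr_coalition.
Qed.

Lemma value_ge0 r A : 0 <= value net (coalition r A).
Proof. by rewrite value_coalition subr_ge0 mst_cost_le_star. Qed.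

(** Serves both the lone retailer, where telescoping starts, and the pair of [r] with one
    consumer. *)
Lemma value_card_le1 r A : (#|A| <= 1)%N -> value net (coalition r A) = 0.
Proof. by move=> A1; rewrite value_coalition mst_cost_card_le1 // subrr. Qed.

(** Since orderings start with [r], the predecessors of a consumer again form a coalition of [r],
    which lets marginal values telescope. *)
Lemma predecessors_ordering r (s : seq Bt) (b : Bt) :
  predecessors (inl r :: map inr s) (inr b)
    = coalition r [set c in take (index b s) s].
Proof.
rewrite /predecessors /= index_map; last by move=> x y [].
rewrite -map_take; apply/setP => -[s'|c].
  by rewrite inl_coalition !inE; case: mapP => [[]//|_]; rewrite orbF.
by rewrite inr_coalition !inE /= mem_map // => x y [].
Qed.

Lemma setU_inr_coalition r A b : inr b |: coalition r A = coalition r (b |: A).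
Proof. by rewrite /coalition imsetU1 finset.setUCA. Qed.

Lemma sum_marginal r A (s : seq Bt) : perm_eq s (enum A) ->
  \sum_(b in A) marginal net (inl r :: map inr s) b = value net (coalition r A).
Proof.
move=> sA; have us : uniq s by rewrite (perm_uniq sA) enum_uniq.
rewrite -big_enum -(perm_big _ sA) /=.
have -> : A = [set c in s] by apply/setP => c; rewrite inE (perm_mem sA) mem_enum.
have value0 : value net (coalition r [set c in take 0 s]) = 0.
  by rewrite value_card_le1 // take0 cardsE card0.
(* The empty ordering is split off because indexing into [s] needs a default element [b0]. *)
case: s us {sA} value0 => [|b0 s0] us value0; first by rewrite big_nil value0.
set s := b0 :: s0 in us value0 *.
rewrite (big_nth b0).
(* The consumer at position [i] extends the prefix of length [i] to the one of length [i.+1]. *)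
rewrite (eq_big_nat _ _ (F2 := fun i =>
    value net (coalition r [set c in take i.+1 s])
      - value net (coalition r [set c in take i s]))).
  by rewrite telescope_sumr // take_size value0 subr0.
move=> i /andP[_ ilt]; rewrite /marginal predecessors_ordering index_uniq //.
rewrite setU_inr_coalition; congr (value _ (coalition r _) - _).
by apply/setP => c; rewrite (take_nth b0) // !inE mem_rcons inE.
Qed.

(** After exchanging the sums, each of the [k!] orderings contributes the full value, and the factor
    [1/k!] cancels their number. *)
Lemma sum_shapley r A :
  \sum_(b in A) shapley net r (coalition r A) b = value net (coalition r A).
Proof.
rewrite /shapley consumers_coalition -mulr_sumr exchange_big /=.
rewrite /orderings consumers_coalition big_map big_seq.
rewrite (eq_bigr (fun=> value net (coalition r A))); last first.
  by move=> s; rewrite mem_permutations; exact: sum_marginal.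
rewrite -big_seq big_const_seq count_predT size_permutations ?enum_uniq //.
by rewrite -cardE iter_addr_0 -[X in _ * X]mulr_natl mulKf.
Qed.

Lemma shapley_pair r b : shapley net r (coalition r [set b]%SET) b = 0.
Proof.
have := sum_shapley r [set b]%SET.
by rewrite big_set1 value_card_le1 ?cards1.
Qed.

End GameTheory.

Theorem proposition1
  (R : realType) (Rt Bt : finType)
  (* cost networks, prices and subsidies *)
  (net : forall r : Rt, cost_network R Bt r)
  (price : Rt -> R)
  (kappa : {set player Rt Bt} -> Rt -> R)
  (delta : {set player Rt Bt} -> Rt -> Bt -> R)
  (subsidy_shapley : forall (C : {set player Rt Bt}) (r : Rt) (b : Bt),
     viable C -> inl r \in C -> inr b \in C ->
     kappa C r * delta C r b = shapley net r C b)
  (* the retailer coalitions *)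
  (S : Rt -> {set player Rt Bt}) (B : Rt -> {set Bt})
  (S_def : forall r, S r = inl r |: [set inr b | b in B r])
  (S_cover : \bigcup_(r : Rt) S r = [set: player Rt Bt])
  (S_one_retailer : forall r s : Rt, inl s \in S r -> s = r)
  (S_disjoint : forall r s : Rt, r != s -> S r :&: S s = finset.set0)
  (* stochastic demand *)
  (d : measure_display) (Omega : measurableType d) (P : probability Omega R)
  (time : Type)
  (mu : Bt -> R) (sigma : R)
  (alpha : Bt -> time -> {RV P >-> R})
  (alpha_normal : forall (b : Bt) (t : time) (A : set R), measurable A ->
     distribution P (alpha b t) A = normal_law (mu b) sigma A)
  (Plo Phi : Bt -> R)
  (Plo_ge0 : forall b, 0 <= Plo b)
  (Pd : Bt -> time -> {RV P >-> R})
  (Pd_bounds : forall (b : Bt) (t : time) (w : Omega),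
     Plo b <= Pd b t w <= Phi b) :
  forall (r : Rt) (t : time), \forall w \ae P,
    coalition_profit net kappa delta price (S r) r
        (fun b => alpha b t w) (fun b => Pd b t w)
    >= \sum_(b in consumers_in (S r))
         consumer_profit net kappa delta price [set inl r; inr b] r b
           (alpha b t w) (Pd b t w).
Proof.
move=> r t; apply: aeW => w.
rewrite /coalition_profit S_def -/(coalition r (B r)) consumers_coalition.
(* Consumer by consumer, the two profits differ exactly by the Shapley value in the large coalition,
   as the subsidy in the pair vanishes. *)
rewrite -subr_ge0 -sumrB.
rewrite (eq_bigr (fun b => shapley net r (coalition r (B r)) b)).
  by rewrite sum_shapley value_ge0.
move=> b bB.
have -> : [set inl r; inr b] = coalition r [set b]%SET :> {set player Rt Bt}.
  by rewrite /coalition imset_set1.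
rewrite /consumer_profit !subsidy_shapley
  ?viable_coalition ?inl_coalition ?inr_coalition ?inE //.
by rewrite shapley_pair; ring.
Qed.
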